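(* For $n>0$ and $J\subseteq S$, there is a bijection $\mathfrak{S}_n^J(231)\simeq\mathrm{NC}_n^J$.
   Context: $\mathfrak{S}_n$ is the symmetric group on $[n]=\{1,\dots,n\}$, $s_i=(i,i+1)$, $S=\{s_1,\dots,s_{n-1}\}$, one-line notation $w=w_1\cdots w_n$. For $J\subseteq S$, $\mathfrak{S}_n^J$ is the set of $w$ with $w_i<w_{i+1}$ whenever $s_i\in J$. Writing $J=S\setminus\{s_{j_1},\dots,s_{j_r}\}$ with $j_1<\dots<j_r$, the $J$-regions are $\{1,\dots,j_1\},\{j_1+1,\dots,j_2\},\dots,\{j_r+1,\dots,n\}$. $\mathfrak{S}_n^J(231)$ is the set of $w\in\mathfrak{S}_n^J$ admitting no indices $i<j<k$ in pairwise different $J$-regions with $w_k<w_i<w_j$ and $w_i=w_k+1$. For a set partition $\mathbf P$ of $[n]$, a bump is a pair $(a,b)$, $a<b$, with $a,b$ in the same part and no element of that part strictly between them. $\mathbf P$ is $J$-noncrossing if: (NC1) no two distinct elements of the same $J$-region lie in the same part; (NC2) whenever two distinct bumps $(i_1,i_2),(j_1,j_2)$ satisfy $i_1<j_1<i_2<j_2$, either $i_1,j_1$ lie in the same $J$-region or $i_2,j_1$ lie in the same $J$-region; (NC3) whenever two distinct bumps satisfy $i_1<j_1<j_2<i_2$, then $i_1$ and $j_1$ lie in different $J$-regions. $\mathrm{NC}_n^J$ denotes the set of $J$-noncrossing partitions of $[n]$. *)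

(* Defs.v *)
(* Positions and values of [n] = {1..n} are encoded 0-based by 'I_n.
   The generator s_i (1 <= i <= n-1) is encoded by j : 'I_n.-1 with j = i-1;
   s_i swaps the (0-based) positions j and j+1. *)
From mathcomp Require Import all_boot all_order.
From mathcomp Require Import perm.
Set Implicit Arguments. Unset Strict Implicit. Unset Printing Implicit Defensive.

Section JDefs.
Variable n : nat.
Variable J : {set 'I_n.-1}.

Definition inJ (k : nat) : bool := [exists j in J, val j == k].

(* index of the J-region containing the 0-based position p :
   number of cut points s_{k+1} \notin J with k < p *)
Definition region (p : nat) : nat := #|[set k : 'I_n.-1 | (val k < p) && (k \notin J)]|.

Definition sameRegion (p q : nat) : bool := region p == region q.

Definition in_parabolic (w : {perm 'I_n}) : bool :=
  [forall p : 'I_n, forall q : 'I_n,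
     ((val q == (val p).+1) && inJ p) ==> (val (w p) < val (w q))].

Definition avoids231 (w : {perm 'I_n}) : bool :=
  ~~ [exists i : 'I_n, exists j : 'I_n, exists k : 'I_n,
       [&& val i < val j, val j < val k,
           ~~ sameRegion i j, ~~ sameRegion j k, ~~ sameRegion i k,
           val (w k) < val (w i), val (w i) < val (w j) &
           val (w i) == (val (w k)).+1]].

Definition Av231J : {set {perm 'I_n}} :=
  [set w : {perm 'I_n} | in_parabolic w && avoids231 w].

Definition bump (P : {set {set 'I_n}}) (a b : 'I_n) : bool :=
  [exists B in P, [&& a \in B, b \in B, val a < val b &
     [forall c in B, ~~ ((val a < val c) && (val c < val b))]]].

Definition NC1 (P : {set {set 'I_n}}) : bool :=
  [forall x : 'I_n, forall y : 'I_n,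
     ((x != y) && sameRegion x y) ==> ~~ [exists B in P, (x \in B) && (y \in B)]].

Definition NC2 (P : {set {set 'I_n}}) : bool :=
  [forall i1 : 'I_n, forall i2 : 'I_n, forall j1 : 'I_n, forall j2 : 'I_n,
     [&& bump P i1 i2, bump P j1 j2, (i1, i2) != (j1, j2),
         val i1 < val j1, val j1 < val i2 & val i2 < val j2]
     ==> (sameRegion i1 j1 || sameRegion i2 j1)].

Definition NC3 (P : {set {set 'I_n}}) : bool :=
  [forall i1 : 'I_n, forall i2 : 'I_n, forall j1 : 'I_n, forall j2 : 'I_n,
     [&& bump P i1 i2, bump P j1 j2, (i1, i2) != (j1, j2),
         val i1 < val j1, val j1 < val j2 & val j2 < val i2]
     ==> ~~ sameRegion i1 j1].

Definition NCJ : {set {set {set 'I_n}}} :=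
  [set P : {set {set 'I_n}} | [&& partition P [set: 'I_n], NC1 P, NC2 P & NC3 P]].

End JDefs.

(* Main.v *)
(** The partition attached to [w] has as its parts the maximal sets of positions
carrying consecutive values that decrease from left to right, so that its bumps
are the pairs [i < k] with [w i = w k + 1].

Two parts whose ranges of regions share a region [r] are compared by their last
elements of region at most [r]: larger region first, then smaller position.
Every [w] avoiding 231 respects this comparison, and between parts whose ranges
are disjoint the order of values is forced by the requirement that successive
parts be joined by an ascent; hence [w] is recovered from its partition.

Conversely, (NC2) and (NC3) say that the comparison of two parts of a
[J]-noncrossing partition does not change when [r] grows.  As the parts at a
given [r] are totally ordered, this makes the comparison acyclic.  Enumerating
the parts greedily along it, least last element first, yields a permutation with
the given partition. *)
Require Import Defs.
From mathcomp Require Import all_boot all_order.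
From mathcomp Require Import perm.
From mathcomp Require Import zify.

Set Implicit Arguments.
Unset Strict Implicit.

(** * Minimal elements and greedy orders for a relation that is only partly transitive *)

Section GreedyOrder.
Variables (T : finType) (R : rel T) (m : T -> nat) (P : {set T}).
Hypothesis Rirr : {in P, forall x, ~~ R x x}.
(** Transitivity is asked only through a middle element of least weight. For blocks weighted by
    their last element, such a middle block ends in a region that all three blocks span; in general
    the outer two need not share a region. *)
Hypothesis Rtrans : forall a x b, a \in P -> x \in P -> b \in P ->
  R a x -> R x b -> m x <= m a -> m x <= m b -> R a b.

(* Removing the element [X] of least [m] from a set without minimal elements
   leaves a set without minimal elements, since [X] can be bypassed. *)
Lemma exists_minimal (K : {set T}) : K \subset P -> K != set0 ->
  exists2 x, x \in K & {in K, forall y, ~~ R y x}.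
Proof.
have [N] := ubnP #|K|; elim: N K => // N IH K ltKN sKP Kn0.
have [/existsP[x /andP[xK /forallP xmin]]|noMin] :=
    boolP [exists x in K, [forall y in K, ~~ R y x]].
  by exists x => // y yK; have := xmin y; rewrite yK.
have pred_of x : x \in K -> exists2 y, y \in K & R y x.
  move=> xK; move: noMin; rewrite negb_exists => /forallP/(_ x).
  rewrite xK negb_forall => /existsP[y]; rewrite negb_imply negbK.
  by case/andP=> yK yx; exists y.
have [x0 x0K] := set0Pn _ Kn0.
have [X XK Xmin] := @arg_minnP _ x0 (fun x => x \in K) m x0K.
have [A AK AX] := pred_of X XK.
have PK x : x \in K -> x \in P by move/(subsetP sKP).
have AnX : A != X by apply/eqP => E; move: AX; rewrite E; apply/negP/Rirr/PK.
have AK' : A \in K :\ X by rewrite !inE AnX.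
have [|||M MK' Mmin] := IH (K :\ X).
- by move: ltKN; rewrite (cardsD1 X K) XK; lia.
- exact: subset_trans (subsetDl _ _) sKP.
- by apply/set0Pn; exists A.
have MK : M \in K by move: MK'; rewrite !inE => /andP[].
have [y yK yM] := pred_of M MK.
have yX : y = X.
  apply/eqP/negPn/negP => ynX; move: yM; apply/negP/Mmin.
  by rewrite !inE ynX.
have := Mmin A AK'; rewrite (Rtrans (PK _ AK) (PK _ XK) (PK _ MK)) //.
- by rewrite -yX.
- exact: Xmin.
- exact: Xmin.
Qed.

(** Among the minimal elements, one of least weight is removed each time. *)
Lemma exists_greedy_order (K : {set T}) : K \subset P ->
  exists s : seq T, [/\ uniq s, s =i K,
    pairwise (fun x y => ~~ R y x) s &
    sorted (fun x y => R x y || (m x <= m y)) s].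
Proof.
have [N] := ubnP #|K|; elim: N K => // N IH K ltKN sKP.
have [->|Kn0] := eqVneq K set0.
  by exists [::]; split => // x; rewrite inE.
pose isMin x := (x \in K) && [forall y in K, ~~ R y x].
have [x0 x0K x0min] := exists_minimal sKP Kn0.
have x0M : isMin x0.
  by rewrite /isMin x0K; apply/forallP => y; apply/implyP; apply: x0min.
have [X /andP[XK /forallP Xmin] Xleast] := @arg_minnP _ x0 isMin m x0M.
have [||s [us sK ps ss]] := IH (K :\ X).
- by move: ltKN; rewrite (cardsD1 X K) XK; lia.
- exact: subset_trans (subsetDl _ _) sKP.
exists (X :: s); split.
- by rewrite /= us sK !inE eqxx.
- by move=> x; rewrite inE sK !inE; case: eqP => // ->.
- rewrite /= ps andbT; apply/allP => y; rewrite sK !inE => /andP[_ yK].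
  by have := Xmin y; rewrite yK.
case: s us sK ps ss => // y s _ sK /= /andP[/allP ymin _] ->; rewrite andbT.
(* If [R X y] fails, then [y] was already minimal when [X] was chosen, and the choice of [X] gives
   [m X <= m y]. *)
have [//|nXy /=] := boolP (R X y).
have yK' : y \in K :\ X by rewrite -sK mem_head.
have yK : y \in K by move: yK'; rewrite !inE => /andP[].
apply: Xleast; rewrite /isMin yK; apply/forallP => z; apply/implyP => zK.
have [->//|znX] := eqVneq z X.
have : z \in y :: s by rewrite sK !inE znX.
rewrite inE => /predU1P[->|/ymin //]; exact/Rirr/(subsetP sKP).
Qed.

End GreedyOrder.

(** * Permutations determined by their order, and runs of consecutive values *)

Section Permutations.
Variables (n : nat).
Implicit Types (w : {perm 'I_n}) (p q x y : 'I_n).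

Lemma perm_val_onto w v : v < n -> exists x, w x = v :> nat.
Proof. by move=> lt_vn; exists (w^-1%g (Ordinal lt_vn)); rewrite permKV. Qed.

Lemma perm_val_inj w x y : w x = w y :> nat -> x = y.
Proof. by move/val_inj/perm_inj. Qed.

Lemma exists_perm_of_key (K : 'I_n -> nat) : injective K ->
  exists w, forall p q, (w p < w q) = (K p < K q).
Proof.
move=> Kinj.
pose rk p := #|[set q | K q < K p]|.
have rk_lt p : rk p < n.
  rewrite -[X in _ < X]card_ord -cardsT; apply: proper_card.
  rewrite properT; apply/eqP => E; have := in_setT p; rewrite -E inE; lia.
have rk_mono p q : K p < K q -> rk p < rk q.
  move=> lt_pq; apply: proper_card; apply/properP; split.
    by apply/subsetP => x; rewrite !inE; lia.
  by exists p; rewrite !inE; lia.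
have rk_ltE p q : (rk p < rk q) = (K p < K q).
  apply/idP/idP => [lt_rk|]; last exact: rk_mono.
  have [//|/rk_mono|/Kinj E] := ltngtP (K p) (K q); first lia.
  by move: lt_rk; rewrite E ltnn.
have f_inj : injective (fun p => Ordinal (rk_lt p)).
  move=> p q [E]; apply: Kinj.
  by case: (ltngtP (K p) (K q)) => // /rk_mono; rewrite E ltnn.
by exists (perm f_inj) => p q; rewrite !permE /= rk_ltE.
Qed.

Lemma eq_perm_of_lt w w' :
  (forall p q, w p < w q -> w' p < w' q) -> w = w'.
Proof.
(* Induction on the value: [u'] keeps [p] strictly above the position holding the preceding value of
   [u], so values cannot drop. *)
have le_perm (u u' : {perm 'I_n}) :
    (forall p q, u p < u q -> u' p < u' q) -> forall p, u p <= u' p.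
  move=> mono p; move: {2}(nat_of_ord (u p)) (erefl (nat_of_ord (u p))) => v.
  elim: v p => [|v IH] p Ep; first by rewrite Ep.
  have [|x Ex] := @perm_val_onto u v; first by have := ltn_ord (u p); lia.
  by have := IH x Ex; have := mono x p; lia.
move=> mono; apply/permP => p; apply/val_inj/eqP => /=.
rewrite eqn_leq !le_perm // => x y lt_xy.
have [//|/mono|/perm_val_inj E] := ltngtP (w x) (w y); first lia.
by rewrite E ltnn in lt_xy.
Qed.

(** The fibres of [c] are intervals of values, so one can descend from [q] to [p] one value at a
    time inside a fibre. Used in both directions to identify runs with the blocks of a given
    partition. *)
Lemma kernel_of_adjacent (T T' : Type) w (c : 'I_n -> T) (c' : 'I_n -> T') :
  (forall p q x, c p = c q -> w p <= w x <= w q -> c x = c q) ->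
  (forall p q, w q = (w p).+1 :> nat -> c p = c q -> c' p = c' q) ->
  forall p q, c p = c q -> c' p = c' q.
Proof.
move=> conv adj p q.
wlog le_pq : p q / w p <= w q.
  by move=> H E; case/orP: (leq_total (w p) (w q)) => /H/(_ _)->.
move: {2}(w q - w p) (erefl (w q - w p)) => d.
elim: d q le_pq => [|d IH] q le_pq Ed E.
  by congr c'; apply: (@perm_val_inj w); lia.
have [|x Ex] := @perm_val_onto w (w q).-1; first by have := ltn_ord (w q); lia.
have cx : c x = c q by apply: conv E _; lia.
rewrite (IH x) ?E ?cx //; [|lia|lia].
by apply: adj cx; lia.
Qed.

Definition ascent_top w x := [exists y, ((w y).+1 == w x) && (y < x)].

(* Ascents of the inverse permutation are counted, so [run w] is constant exactly
   on the positions of a maximal run of consecutive values without ascent. *)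
Definition run w p := #|[set x | ascent_top w x && (w x <= w p)]|.

Lemma leq_run w p q : w p <= w q -> run w p <= run w q.
Proof.
move=> le_pq; apply/subset_leq_card/subsetP => x; rewrite !inE.
by case/andP=> -> /leq_trans->.
Qed.

Lemma ltn_run w p q : run w p < run w q -> w p < w q.
Proof. by apply: contraTT; rewrite -!leqNgt; apply: leq_run. Qed.

(** The only position that can be counted for [q] and not for [p] is [q] itself, which is an ascent
    top exactly when [p < q]. *)
Lemma run_adjacent w p q : w q = (w p).+1 :> nat ->
  (run w p == run w q) = (q < p).
Proof.
move=> Eq; have npq : p <> q by move=> E; move: Eq; rewrite E; lia.
have nvpq : p <> q :> nat by move/val_inj.
case: (ltnP q p) => le_qp.
  apply/eqP/eq_card => x; rewrite !inE; case: (boolP (ascent_top w x)) => //=.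
  case/existsP=> y /andP[/eqP Ey lt_yx].
  case: (eqVneq (w x : nat) (w q)) => [E|]; last lia.
  have Ex := perm_val_inj E; have Eyp : y = p by apply: (@perm_val_inj w); lia.
  by move: lt_yx; rewrite Ex Eyp; lia.
rewrite ltn_eqF //; apply: proper_card; apply/properP; split.
  by apply/subsetP => x; rewrite !inE => /andP[->]; lia.
exists q; rewrite !inE ?leqnn ?andbT; last by lia.
by apply/existsP; exists p; rewrite Eq eqxx; lia.
Qed.

Lemma run_convex w p q x : run w p = run w q -> w p <= w x <= w q ->
  run w x = run w q.
Proof. by move=> E /andP[/leq_run + /leq_run]; lia. Qed.

Lemma run_decreasing w p q : run w p = run w q -> w p < w q -> q < p.
Proof.
move: {2}(w q - w p) (leqnn (w q - w p)) => d.
elim: d q => [|d IH] q Ed E lt_pq.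
  lia.
have [|x Ex] := @perm_val_onto w (w q).-1; first by have := ltn_ord (w q); lia.
have Exq : run w x = run w q by apply: run_convex E _; lia.
have lt_qx : q < x by rewrite -(@run_adjacent w x q) ?Exq //; lia.
case: (eqVneq (x : nat) p) => [<-//|nxp].
have nwxp : w x <> w p :> nat by move/perm_val_inj => E'; rewrite E' eqxx in nxp.
by apply: ltn_trans lt_qx (IH x _ _ _); lia.
Qed.

End Permutations.

(** * Regions, and the comparison of blocks at a region *)

Section Regions.
Variables (n : nat) (J : {set 'I_n.-1}).
Local Notation reg := (region J).
Implicit Types (w : {perm 'I_n}) (p q x y : 'I_n) (B C : {set 'I_n}).
Implicit Types (P : {set {set 'I_n}}).

Lemma leq_region (p q : nat) : p <= q -> reg p <= reg q.
Proof.
move=> le_pq; apply/subset_leq_card/subsetP => k; rewrite !inE.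
by case/andP=> /leq_trans-> // ->.
Qed.

Lemma ltn_region (p q : nat) : reg p < reg q -> p < q.
Proof. by apply: contraTT; rewrite -!leqNgt; apply: leq_region. Qed.

Lemma region_succ (p : nat) : inJ J p -> reg p.+1 = reg p.
Proof.
case/existsP=> j /andP[jJ /eqP jp]; apply: eq_card => k; rewrite !inE ltnS.
case: (eqVneq (val k) p) => [kp|]; last by rewrite leq_eqVlt => /negPf->.
by rewrite (_ : k = j) ?jJ ?andbF //; apply: val_inj; rewrite kp jp.
Qed.

Lemma inJ_of_region (p q k : nat) : q < n -> p <= k < q -> reg p = reg q ->
  inJ J k.
Proof.
move=> lt_qn /andP[le_pk lt_kq] Epq.
have lt_kn : k < n.-1 by lia.
apply/existsP; exists (Ordinal lt_kn); rewrite /= eqxx andbT.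
apply/negPn/negP => kJ.
suff : reg p < reg q by rewrite Epq ltnn.
apply: proper_card; apply/properP; split.
  by apply/subsetP => x; rewrite !inE => /andP[+ ->]; lia.
by exists (Ordinal lt_kn); rewrite !inE ?kJ /=; lia.
Qed.

Lemma parabolic_increasing w p q : in_parabolic J w ->
  p < q -> reg p = reg q -> w p < w q.
Proof.
move=> /forallP wJ.
have step x y : y = x.+1 :> nat -> inJ J x -> w x < w y.
  by move=> E Jx; have /forallP/(_ y)/implyP-> := wJ x; rewrite //= E eqxx.
move: {2}(q - p) (erefl (q - p)) => d; elim: d q => [|d IH] q Ed lt_pq Epq.
  lia.
have ltq := ltn_ord q.
have lt_x : q.-1 < n by lia.
pose x := Ordinal lt_x.
have lt_xq : w x < w q.
  by apply: step => /=; [lia|apply: (@inJ_of_region p q) => //; lia].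
have [Exp|lt_px] := eqVneq (x : nat) p; first by rewrite -(val_inj Exp).
apply: ltn_trans lt_xq; apply: IH => /=; [lia|move: lt_px => /=; lia|].
by have := @leq_region p q.-1; have := @leq_region q.-1 q; lia.
Qed.

(** A block may span [r] without having an element there; its last element up to [r] then represents
    it in [active]. *)
Definition spans r B :=
  [exists x in B, reg x <= r] && [exists x in B, r <= reg x].

Definition active r B p := [&& p \in B, reg p <= r,
  [forall x in B, (reg x <= r) ==> (x <= p)] & [exists x in B, r <= reg x]].

(** The order of values forced on active elements: in one region by the increase of [w], in
    different regions by 231-avoidance, the later one lying under a bump of the other block. *)
Definition key_lt p q := (reg q < reg p) || ((reg p == reg q) && (p < q)).

Definition before r B C :=
  [exists p, exists q, [&& active r B p, active r C q & key_lt p q]].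

Lemma spansP r B : reflect
  (exists x y, [/\ x \in B, y \in B, reg x <= r & r <= reg y]) (spans r B).
Proof.
apply: (iffP andP) => [[/existsP[x /andP[xB hx]] /existsP[y /andP[yB hy]]]|].
  by exists x, y.
case=> x [y [xB yB hx hy]]; split; apply/existsP.
  by exists x; rewrite xB.
by exists y; rewrite yB.
Qed.

Lemma activeP r B p : reflect
  [/\ p \in B, reg p <= r, (forall x, x \in B -> reg x <= r -> x <= p) &
      exists2 y, y \in B & r <= reg y] (active r B p).
Proof.
apply: (iffP and4P) => -[pB hp pmax yB]; split=> //.
- by move=> x xB hx; have /forallP/(_ x) := pmax; rewrite xB hx.
- by case/existsP: yB => y /andP[yB hy]; exists y.
- by apply/forallP => x; apply/implyP => xB; apply/implyP; apply: pmax.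
by case: yB => y yB hy; apply/existsP; exists y; rewrite yB.
Qed.

Lemma beforeP r B C : reflect
  (exists p q, [/\ active r B p, active r C q & key_lt p q]) (before r B C).
Proof.
apply: (iffP existsP) => [[p /existsP[q /and3P[]]]|[p [q [hp hq hpq]]]].
  by exists p, q.
by exists p; apply/existsP; exists q; rewrite hp hq.
Qed.

Lemma active_unique r B p q : active r B p -> active r B q -> p = q.
Proof.
case/activeP=> pB hp pmax _ /activeP[qB hq qmax _].
by apply/val_inj/eqP; rewrite eqn_leq /= pmax ?qmax.
Qed.

Lemma active_spans r B p : active r B p -> spans r B.
Proof. by case/activeP=> pB hp _ [y yB hy]; apply/spansP; exists p, y. Qed.

Lemma spans_active r B : spans r B -> exists p, active r B p.
Proof.
case/spansP=> x [y [xB yB hx hy]].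
have hx' : (x \in B) && (reg x <= r) by rewrite xB.
have [p /andP[pB hp] pmax] :=
  @arg_maxnP _ x (fun z => (z \in B) && (reg z <= r)) (@nat_of_ord n) hx'.
exists p; apply/activeP; split=> //; last by exists y.
by move=> z zB hz; apply: pmax; rewrite zB.
Qed.

Lemma spans_mem x B : x \in B -> spans (reg x) B.
Proof. by move=> xB; apply/spansP; exists x, x. Qed.

Lemma before_spans r B C : before r B C -> spans r B /\ spans r C.
Proof. by case/beforeP=> p [q [/active_spans ? /active_spans ?]]. Qed.

Lemma before_irrefl r B : ~~ before r B B.
Proof.
apply/beforeP => -[p [q [hp hq]]]; rewrite (active_unique hp hq) /key_lt.
by rewrite !ltnn andbF.
Qed.

Lemma before_trans r B C D : before r B C -> before r C D -> before r B D.
Proof.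
move=> /beforeP[p [q [hp hq hpq]]] /beforeP[q' [t [hq' ht hqt]]].
apply/beforeP; exists p, t; split=> //.
by rewrite (active_unique hq' hq) in hqt; move: hpq hqt; rewrite /key_lt; lia.
Qed.

Lemma before_total P r B C : trivIset P -> B \in P -> C \in P -> B != C ->
  spans r B -> spans r C -> before r B C || before r C B.
Proof.
move=> tP BP CP nBC /spans_active[p hp] /spans_active[q hq].
have npq : p <> q :> nat.
  move/val_inj => E; move/eqP: nBC; apply.
  have [pB _ _ _] := activeP _ _ _ hp; have [qC _ _ _] := activeP _ _ _ hq.
  by rewrite -(def_pblock tP BP pB) -(def_pblock tP CP qC) E.
have : key_lt p q || key_lt q p by rewrite /key_lt; lia.
by case/orP=> h; apply/orP; [left|right]; apply/beforeP;
  [exists p, q|exists q, p].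
Qed.

End Regions.

(** * From permutations to partitions: noncrossing conditions and injectivity *)

Section PartitionOfPermutation.
Variables (n : nat) (J : {set 'I_n.-1}).
Local Notation reg := (region J).
Implicit Types (w : {perm 'I_n}) (p q x y : 'I_n) (B C : {set 'I_n}).

Definition run_partition w := preim_partition (run w) [set: 'I_n].

Lemma run_partitionP w : partition (run_partition w) [set: 'I_n].
Proof. exact: preim_partitionP. Qed.

Lemma trivIset_run_partition w : trivIset (run_partition w).
Proof. by case/and3P: (run_partitionP w). Qed.

Lemma mem_run_block w p q :
  (q \in pblock (run_partition w) p) = (run w p == run w q).
Proof.
rewrite pblock_equivalence_partition ?inE // => x y z _ _ _.
by split=> [|/eqP h]; rewrite /= ?eqxx ?h.
Qed.

Lemma run_block_mem w p : pblock (run_partition w) p \in run_partition w.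
Proof.
by apply: pblock_mem; rewrite (cover_partition (run_partitionP w)) inE.
Qed.

Lemma run_block_eq w B p : B \in run_partition w -> p \in B ->
  B = pblock (run_partition w) p.
Proof. by move=> BP pB; rewrite (def_pblock (trivIset_run_partition w) BP pB). Qed.

Lemma run_eq w B p q : B \in run_partition w -> p \in B -> q \in B ->
  run w p = run w q.
Proof.
by move=> BP pB; rewrite (run_block_eq BP pB) mem_run_block => /eqP.
Qed.

(** The position of value [w q + 1] is in the same run and left of [q]; if it were not [p], it would
    lie strictly between [p] and [q]. *)
Lemma run_next w p q : run w p = run w q -> p < q ->
  (forall x, run w x = run w p -> ~~ (p < x < q)) -> w p = (w q).+1 :> nat.
Proof.
move=> E lt_pq gap.
have lt_w : w q < w p.
  have [/(run_decreasing E)|//|/perm_val_inj Epq] := ltngtP (w p) (w q); first lia.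
  by rewrite Epq ltnn in lt_pq.
have [|x Ex] := @perm_val_onto n w (w q).+1; first by have := ltn_ord (w p); lia.
have Exp : run w x = run w p by apply: (run_convex (esym E)); lia.
have lt_xq : x < q by apply: (@run_decreasing _ w); rewrite ?Exp //; lia.
have [lt_w'|lt_w'|/perm_val_inj<- //] := ltngtP (w x) (w p); last lia.
by have := gap x Exp; have := run_decreasing Exp lt_w'; lia.
Qed.

Lemma run_bump w p q : Defs.bump (run_partition w) p q ->
  p < q /\ w p = (w q).+1 :> nat.
Proof.
case/existsP=> B /andP[BP /and4P[pB qB lt_pq /forallP gap]]; split=> //.
apply: run_next => // [|x Ex]; first exact: run_eq BP pB qB.
by have := gap x; rewrite (run_block_eq BP pB) mem_run_block Ex eqxx.
Qed.

Lemma avoids_lt w (i j k : 'I_n) : avoids231 J w -> w i = (w k).+1 :> nat ->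
  reg i < reg j -> reg j < reg k -> w j < w i.
Proof.
move=> av Eik lt_ij lt_jk; rewrite ltnNge leq_eqVlt; apply/negP => /orP[/eqP|] h.
  by move: lt_ij; rewrite (perm_val_inj h) ltnn.
move/negP: av; apply; apply/existsP; exists i; apply/existsP; exists j.
apply/existsP; exists k; rewrite /sameRegion /= Eik eqxx.
have := ltn_region lt_ij; have := ltn_region lt_jk; lia.
Qed.

Lemma run_partition_NC1 w : in_parabolic J w -> NC1 J (run_partition w).
Proof.
move=> par; apply/forallP => x; apply/forallP => y; apply/implyP.
case/andP=> nxy /eqP Exy; apply/negP => /existsP[B /and3P[BP xB yB]].
wlog lt_xy : x y nxy Exy xB yB / x < y.
  move=> H; have [lt|lt|/val_inj E] := ltngtP x y; first exact: (H x y).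
    by apply: (H y x) => //; rewrite eq_sym.
  by rewrite E eqxx in nxy.
have := run_decreasing (run_eq BP xB yB) (parabolic_increasing par lt_xy Exy).
lia.
Qed.

(** If both alternatives fail, avoidance at [i1], [j1], [i2] puts [w j1] below [w i2]. Avoidance at
    [j1], [i2], [j2], or the increase inside a region when [i2] and [j2] share one, gives the
    opposite inequality. *)
Lemma run_partition_NC2 w : in_parabolic J w -> avoids231 J w ->
  NC2 J (run_partition w).
Proof.
move=> par av; apply/forallP => i1; apply/forallP => i2; apply/forallP => j1.
apply/forallP => j2; apply/implyP.
case/and5P=> /run_bump[_ Ei] /run_bump[_ Ej] _ lt1 /andP[lt2 lt3].
apply/negPn/negP; rewrite negb_or /sameRegion => /andP[/eqP n1 /eqP n2].
have le1 := @leq_region _ J i1 j1 (ltnW lt1).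
have le2 := @leq_region _ J j1 i2 (ltnW lt2).
have le3 := @leq_region _ J i2 j2 (ltnW lt3).
have lt_w : w j1 < w i1 by apply: avoids_lt Ei _ _; lia.
have nji : w j1 <> w i2 :> nat by move/perm_val_inj => E; rewrite E in lt2; lia.
have [E|n3] := eqVneq (reg i2) (reg j2).
  by have := parabolic_increasing par lt3 E; lia.
by have := avoids_lt av Ej (j := i2); lia.
Qed.

(** With [i1] and [j1] in one region, [w i1 < w j1] yields [w i1 < w j2]. This is refuted by
    avoidance at [i1], [j2], [i2], or by the increase inside a region when [j2] shares one with [j1]
    or [i2]. *)
Lemma run_partition_NC3 w : in_parabolic J w -> avoids231 J w ->
  NC3 J (run_partition w).
Proof.
move=> par av; apply/forallP => i1; apply/forallP => i2; apply/forallP => j1.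
apply/forallP => j2; apply/implyP.
case/and5P=> /run_bump[_ Ei] /run_bump[_ Ej] _ lt1 /andP[lt2 lt3].
apply/negP; rewrite /sameRegion => /eqP E1.
have lt_w := parabolic_increasing par lt1 E1.
have nij : w i1 <> w j2 :> nat by move/perm_val_inj => E; rewrite E in lt1; lia.
have [E|n2] := eqVneq (reg j1) (reg j2).
  by have := parabolic_increasing par lt2 E; lia.
have [E|n3] := eqVneq (reg j2) (reg i2).
  by have := parabolic_increasing par lt3 E; lia.
have := @leq_region _ J j1 j2 (ltnW lt2); have := @leq_region _ J j2 i2 (ltnW lt3).
by have := avoids_lt av Ei (j := j2); lia.
Qed.

Lemma run_partition_NCJ w : w \in Av231J J -> run_partition w \in NCJ J.
Proof.
rewrite !inE => /andP[par av]; rewrite run_partitionP run_partition_NC1 //.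
by rewrite run_partition_NC2 // run_partition_NC3.
Qed.

Lemma before_run_lt w r B C x y : w \in Av231J J ->
  B \in run_partition w -> C \in run_partition w -> x \in B -> y \in C ->
  before J r B C -> w x < w y.
Proof.
rewrite inE => /andP[par av] BP CP xB yC bef.
case/beforeP: (bef) => p [q [hp hq hpq]].
have [pB rp _ _] := activeP _ _ _ _ hp.
have [qC rq qmax [z zC rz]] := activeP _ _ _ _ hq.
have lt_w : w p < w q.
  case/orP: hpq => [lt_r|/andP[/eqP E lt_pq]];
    last exact: (parabolic_increasing par lt_pq E).
  (* Since [C] reaches [r], it continues after [q]; its next element [t] is beyond [r], so [p] is in
     a region strictly between those of [q] and [t]. *)
  have lt_qz : q < z :=
    ltn_region (leq_trans lt_r (leq_trans rp rz)).
  have zq : (z \in C) && (q < z) by rewrite zC.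
  have [t /andP[tC lt_qt] tmin] :=
    @arg_minnP _ z (fun t => (t \in C) && (q < t)) (@nat_of_ord n) zq.
  have lt_rt : r < reg t.
    by rewrite ltnNge; apply/negP => /(qmax _ tC); rewrite leqNgt lt_qt.
  apply: (@avoids_lt _ _ _ t); rewrite ?(leq_ltn_trans rp lt_rt) //.
  apply: run_next => //; first exact: run_eq CP qC tC.
  move=> u Eu; apply/negP => /andP[lt_qu lt_ut].
  have uC : u \in C by rewrite (run_block_eq CP qC) mem_run_block Eu.
  by have := tmin u; rewrite uC lt_qu leqNgt lt_ut => /(_ isT).
(* Runs are intervals of values, so the comparison of [p] with [q] decides that of [B] with [C]. *)
apply: ltn_run; rewrite -(run_eq BP pB xB) -(run_eq CP qC yC) ltn_neqAle.
rewrite (leq_run (ltnW lt_w)) andbT; apply/negP => /eqP E.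
have pC : p \in C by rewrite (run_block_eq CP qC) mem_run_block E.
have EBC : B = C by rewrite (run_block_eq BP pB) (run_block_eq CP pC).
by move: bef; rewrite EBC; apply/negP/before_irrefl.
Qed.

(* Walk through the values from [w p] upwards, keeping an interval [lo, hi] of
   regions covered by blocks already known to lie above [p] for [w'].  A new
   block either meets the interval, and is then known to lie above [p] too, or,
   because successive blocks are joined by an ascent, lies entirely to its
   right. *)
Lemma run_partition_lt w w' p q : w \in Av231J J -> w' \in Av231J J ->
  run_partition w = run_partition w' ->
  w p < w q -> reg q <= reg p -> w' p < w' q.
Proof.
move=> wA wA' EP lt_pq le_r.
set P := run_partition w.
have tP : trivIset P := trivIset_run_partition w.
have PP x : pblock P x \in P := run_block_mem w x.
have PP' x : pblock P x \in run_partition w' by rewrite -EP.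
have inP x : x \in pblock P x by rewrite mem_run_block.
have run' x y : run w x = run w y -> run w' x = run w' y.
  by move=> E; apply: (run_eq (PP' x)) => //; rewrite mem_run_block E.
suff: forall d x, w x = w p + d :> nat -> exists lo hi : nat,
    [/\ lo <= reg p <= hi,
        forall r, lo <= r <= hi -> exists z,
          [/\ w z <= w x, run w' p <= run w' z & spans J r (pblock P z)] &
        (run w' p <= run w' x /\
         {in pblock P x, forall y, lo <= reg y <= hi}) \/
        {in pblock P x, forall y, hi < reg y}].
  move=> /(_ (w q - w p) q) [|lo [hi [hp _ []]]];
    [lia|case=> le_run _|move=> /(_ _ (inP q)); lia].
  (* The inequality of runs is strict unless [p] and [q] share a block, on which both permutations
     decrease. *)
  have [E|nE] := eqVneq (run w' p) (run w' q); last by apply: ltn_run; lia.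
  have Ew : run w p = run w q.
    by apply: (run_eq (PP p)) => //; rewrite /P EP mem_run_block E.
  have lt_qp := run_decreasing Ew lt_pq.
  have [//|/(run_decreasing (esym E))|/perm_val_inj Epq] := ltngtP (w' p) (w' q).
    by lia.
  by move: lt_pq; rewrite Epq ltnn.
have extremes x : exists u v, [/\ u \in pblock P x, v \in pblock P x &
    {in pblock P x, forall y, reg u <= reg y <= reg v}].
  have [u uP umin] := @arg_minnP _ x (fun u => u \in pblock P x)
    (fun u : 'I_n => reg u) (inP x).
  have [v vP vmax] := @arg_maxnP _ x (fun u => u \in pblock P x)
    (fun u : 'I_n => reg u) (inP x).
  by exists u, v; split=> // y yP; apply/andP; split; [apply: umin|apply: vmax].
elim=> [|d IH] y Ey.
  have -> : y = p by apply: (@perm_val_inj n w); lia.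
  have [u [v [uP vP uv]]] := extremes p.
  exists (reg u), (reg v); split; [exact: uv| |by left].
  by move=> r hr; exists p; split=> //; apply/spansP; exists u, v; split=> //; lia.
have [|x Ex] := @perm_val_onto n w (w p + d); first by have := ltn_ord (w y); lia.
have [lo [hi [hp cov st]]] := IH x Ex.
have [lt_yx|le_xy] := ltnP y x.
  have Exy : run w x = run w y.
    by apply/eqP; rewrite run_adjacent //; lia.
  have Eb : pblock P x = pblock P y.
    by apply: same_pblock => //; rewrite mem_run_block Exy.
  exists lo, hi; split=> // [r /cov[z [h1 h2 h3]]|].
    by exists z; split=> //; lia.
  by rewrite -Eb -(run' _ _ Exy).
have nxy : run w x <> run w y.
  by apply/eqP; rewrite run_adjacent; lia.
have le_rxy := @leq_region _ J x y le_xy.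
have lo_y : lo <= reg y by case: st => [[_ /(_ x (inP x))]|/(_ x (inP x))]; lia.
have [/forallP right_y|] := boolP [forall a in pblock P y, hi < reg a].
  exists lo, hi; split=> // [r /cov[z [h1 h2 h3]]|].
    by exists z; split=> //; lia.
  by right=> a aY; have := right_y a; rewrite aY.
rewrite negb_forall => /existsP[a]; rewrite negb_imply -leqNgt => /andP[aY a_hi].
have le_run : run w' p <= run w' y.
  (* This region lies in the interval and between [reg a] and [reg y], so the block of [y] meets
     there an earlier block already known to be above [p]. The comparison of the two is the same for
     [w] and [w']. *)
  have [|z [le_zx le_pz sz]] := cov (maxn lo (minn (reg a) (reg y))); first lia.
  apply: leq_trans le_pz _.
  have nzy : pblock P z != pblock P y.
    apply/eqP => E; apply: nxy; apply: (@run_convex _ w z y).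
      by apply: (run_eq (PP y)) => //; rewrite -E.
    lia.
  have sy : spans J (maxn lo (minn (reg a) (reg y))) (pblock P y).
    have [le_ay|lt_ya] := leqP (reg a) (reg y); apply/spansP.
      by exists a, y; split=> //; lia.
    by exists y, a; split=> //; lia.
  case/orP: (before_total tP (PP z) (PP y) nzy sz sy) => bef.
    exact/leq_run/ltnW/(before_run_lt wA' (PP' z) (PP' y) (inP z) (inP y) bef).
  by have := before_run_lt wA (PP y) (PP z) (inP y) (inP z) bef; lia.
have [u [v [uY vY uv]]] := extremes y.
have u_y := uv y (inP y); have u_a := uv a aY.
(* A region outside the old interval is spanned by the block of [y], as [reg y] is at least [lo] and
   [reg a] at most [hi]. *)
exists (minn lo (reg u)), (maxn hi (reg v)); split; first lia.
  move=> r hr; have [/cov[z [h1 h2 h3]]|out] := boolP (lo <= r <= hi).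
    by exists z; split=> //; lia.
  exists y; split=> //; apply/spansP; have [lt_r|le_r'] := ltnP r lo.
    by exists u, y; split=> //; lia.
  by exists a, v; split=> //; lia.
by left; split=> // z /uv; lia.
Qed.

End PartitionOfPermutation.

(** * From noncrossing partitions to permutations: surjectivity *)

Section PermutationOfPartition.
Variables (n : nat) (J : {set 'I_n.-1}) (P : {set {set 'I_n}}).
Hypothesis partP : partition P [set: 'I_n].
Hypotheses (nc1 : NC1 J P) (nc2 : NC2 J P) (nc3 : NC3 J P).
Local Notation reg := (region J).
Local Notation blk := (pblock P).
Implicit Types (p q x y : 'I_n) (B C : {set 'I_n}).

Lemma partition_trivIset : trivIset P. Proof. by case/and3P: partP. Qed.

Lemma mem_blk x : x \in blk x.
Proof. by rewrite mem_pblock (cover_partition partP) inE. Qed.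

Lemma blk_mem x : blk x \in P.
Proof. by apply: pblock_mem; rewrite (cover_partition partP) inE. Qed.

Lemma blk_eq B x : B \in P -> x \in B -> blk x = B.
Proof. exact: def_pblock partition_trivIset. Qed.

Lemma region_inj_block B x y : B \in P -> x \in B -> y \in B ->
  reg x = reg y -> x = y.
Proof.
move=> BP xB yB E; apply/eqP/negPn/negP => nxy.
have /forallP/(_ x)/forallP/(_ y) := nc1.
rewrite nxy /sameRegion E eqxx => /negP; apply.
by apply/existsP; exists B; rewrite BP xB.
Qed.

Lemma bump_crossing (i1 i2 j1 j2 : 'I_n) : Defs.bump P i1 i2 ->
  Defs.bump P j1 j2 -> i1 < j1 -> j1 < i2 -> i2 < j2 ->
  reg i1 = reg j1 \/ reg i2 = reg j1.
Proof.
move=> bi bj h1 h2 h3.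
have /forallP/(_ i1)/forallP/(_ i2)/forallP/(_ j1)/forallP/(_ j2) := nc2.
rewrite bi bj h1 h2 h3 (_ : (_, _) != _).
  by case/orP=> /eqP; [left|right].
by apply/eqP => -[E _]; rewrite E ltnn in h1.
Qed.

Lemma bump_nesting (i1 i2 j1 j2 : 'I_n) : Defs.bump P i1 i2 ->
  Defs.bump P j1 j2 -> i1 < j1 -> j1 < j2 -> j2 < i2 -> reg i1 <> reg j1.
Proof.
move=> bi bj h1 h2 h3.
have /forallP/(_ i1)/forallP/(_ i2)/forallP/(_ j1)/forallP/(_ j2) := nc3.
rewrite bi bj h1 h2 h3 (_ : (_, _) != _).
  by move/eqP.
by apply/eqP => -[E _]; rewrite E ltnn in h1.
Qed.

Lemma active_mem B x : B \in P -> x \in B -> active J (reg x) B x.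
Proof.
move=> BP xB; apply/activeP; split=> //; last by exists x.
move=> y yB le_yx; rewrite leqNgt; apply/negP => lt_xy.
have E : reg x = reg y by have := @leq_region _ J x y (ltnW lt_xy); lia.
by move: lt_xy; rewrite (region_inj_block BP xB yB E) ltnn.
Qed.

Lemma before_same_region B C x y : B \in P -> C \in P -> x \in B -> y \in C ->
  reg x = reg y -> x < y -> before J (reg x) B C.
Proof.
move=> BP CP xB yC E lt_xy; apply/beforeP; exists x, y; split.
- exact: active_mem.
- by rewrite E; apply: active_mem.
by rewrite /key_lt E eqxx lt_xy orbT.
Qed.

Lemma active_next r B p : B \in P -> active J r B p -> spans J r.+1 B ->
  exists p', [/\ p' \in B, Defs.bump P p p', r < reg p' &
    active J r.+1 B (if reg p' == r.+1 then p' else p)].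
Proof.
move=> BP /activeP[pB rp pmax _] /spansP[_ [z [_ zB _ rz]]].
have lt_pz : p < z by apply: (@ltn_region _ J); apply: leq_ltn_trans rp rz.
have zp : (z \in B) && (p < z) by rewrite zB.
have [t /andP[tB lt_pt] tmin] :=
  @arg_minnP _ z (fun t => (t \in B) && (p < t)) (@nat_of_ord n) zp.
have {zp} tmin x : x \in B -> p < x -> t <= x.
  by move=> xB lt_px; apply: tmin; rewrite xB.
have rt : r < reg t.
  by rewrite ltnNge; apply/negP => /(pmax _ tB); rewrite leqNgt lt_pt.
exists t; split=> //.
  apply/existsP; exists B; rewrite BP pB tB lt_pt /=.
  apply/forallP => c; apply/implyP => cB; apply/negP => /andP[lt_pc].
  by rewrite ltnNge tmin.
have [Et|nt] := eqVneq (reg t) r.+1; first by rewrite -Et; apply: active_mem.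
apply/activeP; split=> //; [exact: leqW| |by exists z].
move=> x xB rx; rewrite leqNgt; apply/negP => /(tmin x xB) le_tx.
by have := @leq_region _ J t x le_tx; lia.
Qed.

(** The next elements satisfy [p' < q']: otherwise the bumps from [q] and [p] cross against (NC2)
    when [reg q < reg p], or nest against (NC3) when the regions agree. *)
Lemma before_step r B C : B \in P -> C \in P -> before J r B C ->
  spans J r.+1 B -> spans J r.+1 C -> before J r.+1 B C.
Proof.
move=> BP CP bef sB sC; case/beforeP: (bef) => p [q [hp hq hpq]].
have [p' [p'B bp rp' hp']] := active_next BP hp sB.
have [q' [q'C bq rq' hq']] := active_next CP hq sC.
have [pB rp _ _] := activeP _ _ _ _ hp; have [qC rq _ _] := activeP _ _ _ _ hq.
have lt_p'q' : p' < q'.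
  have lt_pq' : p < q' := ltn_region (leq_ltn_trans rp rq').
  have lt_qq' : q < q' := ltn_region (leq_ltn_trans rq rq').
  rewrite ltnNge leq_eqVlt; apply/negP => /predU1P[/val_inj E|lt].
    have EBC : B = C by rewrite -(blk_eq BP p'B) -(blk_eq CP q'C) E.
    by move: bef; rewrite EBC; apply/negP/before_irrefl.
  case/orP: hpq => [lt_r|/andP[/eqP E lt_pq]].
    case: (bump_crossing bq bp (ltn_region lt_r) lt_pq' lt) => E.
      by rewrite E ltnn in lt_r.
    by move: rp; rewrite -E leqNgt rq'.
  exact: (bump_nesting bp bq lt_pq lt_qq' lt E).
have le_reg := @leq_region _ J p' q' (ltnW lt_p'q').
apply/beforeP; exists (if reg p' == r.+1 then p' else p),
  (if reg q' == r.+1 then q' else q); split=> //.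
(* If only [p] is replaced, it moves to the larger region; [q] alone cannot be, because [p' < q']
   places [p'] in region [r.+1] as well. *)
move: hpq; rewrite /key_lt; clear - rp rq rp' rq' lt_p'q' le_reg.
by case: (reg p' =P r.+1) => Ep; case: (reg q' =P r.+1) => Eq; lia.
Qed.

Lemma before_up r s B C : B \in P -> C \in P -> r <= s -> before J r B C ->
  spans J s B -> spans J s C -> before J s B C.
Proof.
move=> BP CP le_rs bef sB sC.
have mid t D : spans J r D -> spans J s D -> r <= t -> t <= s -> spans J t D.
  case/spansP=> [x [_ [xD _ hx _]]] /spansP[_ [y [_ yD _ hy]]] le_rt le_ts.
  apply/spansP; exists x, y; split=> //; first exact: leq_trans le_rt.
  exact: leq_trans hy.
have [rB rC] := before_spans bef.
suff: forall d, r + d <= s -> before J (r + d) B C.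
  by move/(_ (s - r)); rewrite subnKC // => ->.
elim=> [|d IH]; first by rewrite addn0.
rewrite addnS => hd; have le_rd := leqW (leq_addr d r).
by apply: before_step (IH (ltnW hd)) _ _ => //; apply: mid.
Qed.

Definition precedes B C := [exists x : 'I_n, before J (reg x) B C].

Definition top B := \max_(x in B) (x : nat).

Lemma topP B : B \in P -> exists2 t, t \in B &
  top B = t /\ (forall x, x \in B -> x <= t).
Proof.
move=> BP; have /set0Pn[x xB] : B != set0.
  by case/and3P: partP => _ _; apply: contraNneq => <-.
have [|t tB Et] := @eq_bigmax_cond _ (mem B) (@nat_of_ord n).
  by apply/card_gt0P; exists x.
exists t => //; split=> // y yB; rewrite -Et.
exact: (@leq_bigmax_cond _ (mem B) (@nat_of_ord n)).
Qed.

Lemma precedes_irrefl : {in P, forall B, ~~ precedes B B}.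
Proof. by move=> B _; apply/existsP => -[x]; apply/negP/before_irrefl. Qed.

(** Both [A] and [C] reach the region of the last element of [B], so both comparisons can be carried
    up to that region and composed there. *)
Lemma precedes_trans A B C : A \in P -> B \in P -> C \in P ->
  precedes A B -> precedes B C -> top B <= top A -> top B <= top C ->
  precedes A C.
Proof.
move=> AP BP CP /existsP[x bx] /existsP[y bef_y] leA leC.
have [a aA [Ea _]] := topP AP; have [b bB [Eb bmax]] := topP BP.
have [c cC [Ec _]] := topP CP.
have [sxA sxB] := before_spans bx; have [syB syC] := before_spans bef_y.
have le_b z : spans J (reg z) B -> reg z <= reg b.
  case/spansP=> _ [u [_ uB _ hu]]; apply: leq_trans hu _.
  exact/leq_region/bmax.
have up (z : nat) (D : {set 'I_n}) (d : 'I_n) : d \in D ->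
    b <= d -> spans J (reg z) B -> spans J (reg z) D -> spans J (reg b) D.
  move=> dD le_bd /le_b le_zb /spansP[u [_ [uD _ hu _]]].
  apply/spansP; exists u, d; split=> //; first exact: leq_trans le_zb.
  exact: leq_region.
apply/existsP; exists b; apply: (@before_trans _ _ _ _ B).
  apply: (before_up AP BP (le_b x sxB) bx); last exact: spans_mem.
  by apply: (up x _ a) => //; rewrite -Ea -Eb.
apply: (before_up BP CP (le_b y syB) bef_y); first exact: spans_mem.
by apply: (up y _ c) => //; rewrite -Ec -Eb.
Qed.

Lemma exists_block_order : exists h : {set 'I_n} -> nat,
  [/\ {in P &, injective h},
      {in P &, forall B C, precedes B C -> h B < h C} &
      {in P &, forall B C, h B < h C ->
        (forall D, D \in P -> ~~ (h B < h D < h C)) ->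
        precedes B C || (top B <= top C)}].
Proof.
have [s [us sP ps ss]] :=
  exists_greedy_order precedes_irrefl precedes_trans (subxx P).
have idx B : B \in P -> index B s < size s by rewrite -sP index_mem.
have nthi B : B \in P -> nth set0 s (index B s) = B.
  by move=> BP; rewrite nth_index // sP.
exists (index^~ s); split.
- by move=> B C BP CP E; rewrite -(nthi B BP) E nthi.
- move=> B C BP CP BC; rewrite ltnNge leq_eqVlt; apply/negP => /orP[/eqP E|lt].
    have EBC : B = C by rewrite -(nthi B BP) -E nthi.
    by move: BC; rewrite EBC; apply/negP/precedes_irrefl.
  have := pairwiseP set0 ps; move=> /(_ _ _ (idx C CP) (idx B BP) lt).
  by rewrite !nthi // BC.
move=> B C BP CP lt gap.
have lt_s := idx C CP.
have Ei : index C s = (index B s).+1.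
  apply/eqP; rewrite eqn_leq lt andbT leqNgt; apply/negP => lt2.
  have lt3 := ltn_trans lt2 lt_s.
  have DP : nth set0 s (index B s).+1 \in P by rewrite -sP mem_nth.
  by have := gap _ DP; rewrite /= index_uniq // ltnSn lt2.
have := sortedP set0 ss (index B s); rewrite -Ei => /(_ lt_s).
by rewrite !nthi.
Qed.

Lemma run_partition_onto : exists2 w, w \in Av231J J & run_partition w = P.
Proof.
have [h [hinj hprec hadj]] := exists_block_order.
pose hb x := h (blk x).
have hbP x y : hb x = hb y -> blk x = blk y by move/hinj; apply; apply: blk_mem.
(* Lexicographic key in base [n]: blocks in the order of [h], positions from right to left inside a
   block. *)
pose K x := hb x * n + (n - x.+1).
have KE x y : (K x < K y) = (hb x < hb y) || ((hb x == hb y) && (y < x)).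
  rewrite /K; have := ltn_ord x; have := ltn_ord y.
  have [lt|lt|->] := ltngtP (hb x) (hb y) => /=; [|nia| lia].
  by nia.
have [|w wE] := @exists_perm_of_key n K.
  move=> x y E; have := KE x y; have := KE y x; rewrite E ltnn => h1 h2.
  apply: val_inj => /=; lia.
have {KE} wE x y : (w x < w y) = (hb x < hb y) || ((hb x == hb y) && (y < x)).
  by rewrite wE KE.
(* Otherwise the block of [k] comes just before that of [i], with [k] the first position of its
   block and [i] the last of its own. The greedy condition then fails: the last elements are in the
   wrong order, and a shared region would contain both [i] and [k], forcing the opposite
   precedence. *)
have desc i k : w i = (w k).+1 :> nat -> i < k -> blk i = blk k.
  move=> Eik lt_ik; apply: hbP; apply/eqP/negPn/negP => nh.
  have gap x : ~~ (w k < w x < w i) by lia.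
  have lt_h : hb k < hb i by have := wE k i; lia.
  have imax x : x \in blk i -> x <= i.
    move=> xi; have Ex : hb x = hb i by rewrite /hb (blk_eq (blk_mem i) xi).
    by have := gap x; rewrite !wE Ex lt_h; lia.
  have kmin x : x \in blk k -> k <= x.
    move=> xk; have Ex : hb x = hb k by rewrite /hb (blk_eq (blk_mem k) xk).
    by have := gap x; rewrite !wE Ex lt_h; lia.
  have [t ti [Et tmax]] := topP (blk_mem i).
  have [u uk [Eu umax]] := topP (blk_mem k).
  have := hadj _ _ (blk_mem k) (blk_mem i) lt_h.
  case/(_ _)/orP => [D DP| |].
  - have [v vD _] := topP DP; rewrite -(blk_eq DP vD) -!/(hb _).
    by have := gap v; rewrite !wE; lia.
  - case/existsP=> x /before_spans[/spansP[a [_ [ak _ ha _]]]].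
    case/spansP=> _ [b [_ bi _ hb']].
    have h1 := @leq_region _ J k a (kmin a ak).
    have h2 := @leq_region _ J b i (imax b bi).
    have h3 := @leq_region _ J i k (ltnW lt_ik).
    have E : reg i = reg k by lia.
    have : precedes (blk i) (blk k).
      apply/existsP; exists i.
      by apply: (before_same_region (x := i) (y := k)); rewrite ?blk_mem ?mem_blk.
    move/(hprec _ _ (blk_mem i) (blk_mem k)); rewrite -!/(hb _); lia.
  rewrite Et Eu; have := imax t ti; have := umax k (mem_blk k); lia.
exists w.
  rewrite inE; apply/andP; split.
    apply/forallP => p; apply/forallP => q; apply/implyP => /andP[/eqP Eq Jp].
    rewrite /= wE; have -> // : hb p < hb q.
    apply: hprec; rewrite ?blk_mem //; apply/existsP; exists p.
    apply: (before_same_region (x := p) (y := q)); rewrite ?blk_mem ?mem_blk //.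
      by rewrite [q : nat]Eq region_succ.
    by rewrite [q : nat]Eq.
  apply/negP => /existsP[i /existsP[j /existsP[k]]].
  case/and5P=> lt_ij lt_jk nij njk /and4P[_ _ lt_wij /eqP Eik].
  have Eb := desc i k Eik (ltn_trans lt_ij lt_jk).
  have rij : reg i < reg j.
    by rewrite ltn_neqAle nij; apply/leq_region/ltnW.
  have rjk : reg j < reg k.
    by rewrite ltn_neqAle njk; apply/leq_region/ltnW.
  (* No element of the block lies between [i] and [k], whose values are consecutive, so [i] is
     active at the region of [j]; being in a later region, [j] belongs to the earlier block. *)
  have : precedes (blk j) (blk i).
    apply/existsP; exists j; apply/beforeP; exists j, i; split.
    - by apply: active_mem; rewrite ?blk_mem ?mem_blk.
    - apply/activeP; split; [exact: mem_blk|exact: ltnW| |].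
        move=> x xi rx; rewrite leqNgt; apply/negP => lt_ix.
        have Ex : hb x = hb i by rewrite /hb (blk_eq (blk_mem i) xi).
        have lt_xk : x < k := ltn_region (leq_ltn_trans rx rjk).
        have := wE x i; have := wE k x; rewrite Ex /hb -Eb eqxx ltnn lt_ix lt_xk /=.
        by move: (Eik : w i = (w k).+1 :> nat); lia.
      by exists k; rewrite ?Eb ?mem_blk // ltnW.
    by rewrite /key_lt rij.
  move/(hprec _ _ (blk_mem j) (blk_mem i)); rewrite -!/(hb _) => lt_h.
  have : w j < w i by rewrite wE lt_h.
  by move: (lt_wij : w i < w j); lia.
rewrite -(preim_partition_pblock partP) /run_partition /preim_partition.
suff E x y : (run w x == run w y) = (blk x == blk y).
  by apply: eq_imset => x; apply/setP => y; rewrite !inE E.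
(* For consecutive values, sharing a run and sharing a block both amount to [q < p]. *)
have adj p q : w q = (w p).+1 :> nat -> (run w p = run w q <-> blk p = blk q).
  move=> Eq; split=> [/eqP|Eb].
    by rewrite run_adjacent // => /(desc q p Eq).
  by apply/eqP; rewrite run_adjacent //; have := wE p q; rewrite /hb Eb eqxx; lia.
apply/eqP/eqP.
  apply: (kernel_of_adjacent (w := w)) => [p q z|p q /adj[]//]; exact: run_convex.
apply: (kernel_of_adjacent (w := w)) => [p q z Eb le_z|p q /adj[]//].
apply: hbP; have := wE q z; have := wE z p; rewrite /hb Eb; lia.
Qed.

End PermutationOfPartition.

(** * The bijection *)

Theorem theorem4p2 (n : nat) (J : {set 'I_n.-1}) : 0 < n ->
  exists f : {perm 'I_n} -> {set {set 'I_n}},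
    {in Av231J J &, injective f} /\ f @: Av231J J = NCJ J.
Proof.
move=> _; exists (@run_partition n); split.
  move=> w w' wA wA' E; apply: eq_perm_of_lt => p q lt_pq.
  have [le_r|lt_r] := leqP (region J q) (region J p).
    exact: (run_partition_lt wA wA' E).
  (* When [q] is in the later region, the comparison lemma is applied from [w'] to [w] with [p] and
     [q] exchanged. *)
  have [//|lt_qp|/perm_val_inj Epq] := ltngtP (w' p) (w' q).
    by have := run_partition_lt wA' wA (esym E) lt_qp (ltnW lt_r); lia.
  by rewrite Epq ltnn in lt_r.
apply/setP => P; apply/imsetP/idP => [[w wA ->]|].
  exact: run_partition_NCJ.
rewrite inE => /and4P[partP nc1 nc2 nc3].
by have [w wA <-] := run_partition_onto partP nc1 nc2 nc3; exists w.
Qed.
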